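(* There exist absolute constants $c,C>0$ such that for every $N\in\mathbb{N}$ the following two bounds hold: $$ d_n(\{w_1,\ldots,w_N\},L_{\mathrm H}[0,1])\le\exp(-c\log^{1/4}N)\quad\text{if } n\ge\exp(C\log^{2/3}N), $$ $$ d_n(\{e(kx)\}_{k=-N}^N,L_0(\mathbb{T}))\le\exp(-c\log^{0.2}N)\quad\text{if } n\ge\exp(C\log^{0.9}N). $$
   Context: $w_0\equiv 1,w_1,w_2,\ldots$ is the Walsh system on $[0,1]$ in the Paley numeration: for $m<2^k$, $m=\sum_{j=1}^k x_j2^{j-1}$ and $y=\sum_{j\ge 1}y_j2^{-j}$ with $x_j,y_j\in\{0,1\}$, $w_m(y)=(-1)^{\sum_{j=1}^k x_jy_j}$. $\mathbb{T}=\mathbb{R}/\mathbb{Z}$ with Lebesgue measure, $e(\theta)=\exp(2\pi i\theta)$, and $\log^a N=(\log N)^a$. For a measurable function $f$ on a measure space with measure $\mu$: $\|f\|_{L_{\mathrm H}}:=\mu\{x\colon f(x)\ne 0\}$ and $\|f\|_{L_0}:=\sup\{t\ge 0\colon\mu\{x\colon|f(x)|\ge t\}\ge t\}$; the spaces $L_{\mathrm H}$ and $L_0$ consist of all measurable functions with distance $\|f-g\|_{L_{\mathrm H}}$, respectively $\|f-g\|_{L_0}$. The Kolmogorov width is $d_n(K,X):=\inf_{Q_n}\sup_{x\in K}\inf_{y\in Q_n}\|x-y\|_X$, the infimum being over linear subspaces $Q_n\subset X$ of dimension at most $n$ (for complex-valued functions, complex linear subspaces may be used; the choice between real and complex dimension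 is immaterial). *)

(* Defs.v *)
From mathcomp Require Import all_boot all_order all_algebra.
From mathcomp Require Import all_classical all_reals all_analysis.
From mathcomp Require Import complex.

Set Implicit Arguments.
Unset Strict Implicit.
Unset Printing Implicit Defensive.

Import Order.TTheory GRing.Theory Num.Theory.
Import numFieldNormedType.Exports.

Local Open Scope classical_set_scope.
Local Open Scope ring_scope.

Definition subspace_dim_le (K : nzRingType) (V : lmodType K) (n : nat)
    (Q : set V) : Prop :=
  exists b : 'I_n -> V,
    Q = [set v | exists a : 'I_n -> K, v = \sum_(i < n) a i *: b i].

(* [X] is the ambient space, as a subset of [V]; the distance between [x] and
   [y] is [nrm (x - y)], where [nrm] need not be homogeneous. *)
Definition kolmogorov_width (R : realType) (K : nzRingType) (V : lmodType K)
    (X : set V) (nrm : V -> \bar R) (n : nat) (S : set V) : \bar R :=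
  ereal_inf [set ereal_sup [set ereal_inf [set nrm (x - y) | y in Q] | x in S]
            | Q in [set Q : set V | Q `<=` X /\ subspace_dim_le n Q]].

(* Functions are not quotiented by almost everywhere equality: the functionals
   below depend only on the values of [f] on [D], up to null sets. *)
Definition LH_norm d (T : measurableType d) (R : realType)
    (mu : {measure set T -> \bar R}) (D : set T) (K : zmodType) (f : T -> K) :
    \bar R :=
  mu (D `&` [set x | f x != 0]).

Definition L0_norm d (T : measurableType d) (R : realType)
    (mu : {measure set T -> \bar R}) (D : set T) (f : T -> R[i]) : \bar R :=
  ereal_sup [set t%:E | t in
    [set t : R | 0 <= t /\
                 (t%:E <= mu (D `&` [set x | (t <= Normc.normc (f x))%R]))%E]].

Definition LH_unit_interval_space (R : realType) : set (R -> R^o) :=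
  [set f : R -> R | measurable_fun (`[0, 1]%classic : set R) f].

Definition width_LH_unit_interval (R : realType) (n : nat)
    (S : set (R -> R^o)) : \bar R :=
  kolmogorov_width (@LH_unit_interval_space R)
    (fun f : R -> R => LH_norm (@lebesgue_measure R) `[0, 1]%classic f) n S.

(* Functions on the circle R/Z are 1-periodic functions on the line; its measure
   is Lebesgue measure on the fundamental domain [0, 1). *)
Definition L0_torus_space (R : realType) : set (R -> R[i]^o) :=
  [set f | [/\ forall x, f (x + 1) = f x,
               measurable_fun [set: R] (fun x => complex.Re (f x)) &
               measurable_fun [set: R] (fun x => complex.Im (f x))]].

Definition width_L0_torus (R : realType) (n : nat)
    (S : set (R -> R[i]^o)) : \bar R :=
  kolmogorov_width (@L0_torus_space R)
    (fun f : R -> R[i] => L0_norm (@lebesgue_measure R) `[0, 1[%classic f) n S.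

(* [nat_digit m j] and [real_digit y j] are the coefficients of 2^j in [m] and
   of 2^-j in [y].  For a dyadic rational [y] in [0, 1) the expansion ending in
   zeros is used; at [y = 1] all the digits are 0. *)
Definition nat_digit (m j : nat) : bool := odd (m %/ 2 ^ j).

Definition real_digit (R : realType) (y : R) (j : nat) : bool :=
  odd (Num.truncn (2 ^+ j * y)).

(* Since m < 2 ^ m, the digits of [m] of rank at least [m] vanish. *)
Definition walsh (R : realType) (m : nat) : R -> R^o := fun y =>
  (-1) ^+ (\sum_(1 <= j < m.+1) nat_digit m j.-1 * real_digit y j)%N.

(* exp (2 pi i theta) *)
Definition e (R : realType) (theta : R) : R[i] :=
  Complex (cos (2 * pi * theta)) (sin (2 * pi * theta)).

Definition walsh_system (R : realType) (N : nat) : set (R -> R^o) :=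
  [set @walsh R m | m in [set m : nat | (1 <= m <= N)%N]].

Definition trig_system (R : realType) (N : nat) : set (R -> R[i]^o) :=
  [set (fun x : R => e (k%:~R * x)) | k in [set k : int | - N%:Z <= k <= N%:Z]].

(* Main.v *)
Require Import Defs.
From mathcomp Require Import all_boot all_order all_algebra.
From mathcomp Require Import all_classical all_reals all_analysis.
From mathcomp Require Import complex measurable_realfun.
From mathcomp Require Import zify ring lra.

(** Both systems are handled by one idea: a frequency of size at most [N] has
    about [K = log2 N] binary digits, so that each function of the system is a
    fixed function of period 1 or 2 applied to a sum of [K] terms, and such a
    sum is concentrated on a window of length about [sqrt K].

    For the Walsh system, [w_m y = (-1) ^ S] with [S] the number of places where
    the digits [m_j] and [y_j] are both 1.  For the trigonometric system,
    [k x = sum_j k_j 2^j x] modulo 1, where each [2^j x] may be replaced by its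
    centred fractional part (sawtooth), so that [e (k x)] is a unimodular
    constant times [e Psi] with [Psi = sum_j k_j sawtooth (2^j x)].  In terms of
    the digits of [x], which are independent and unbiased, both [2 S - w], for [w]
    the number of digits 1 of [m], and [Psi] are, up to a bounded error, sums of at most [K] independent centred
    terms with bounded coefficients ([sum_sawtooth_digits] for [Psi]).  By
    Hoeffding's inequality ([hoeffding_digits]) they are smaller than [s]
    outside a set of measure [2 exp (- s^2 / 8 K)].

    On the window, the outer function agrees with a polynomial of degree O(s):
    exactly for [(-1) ^ S], by interpolation at [s + 1] consecutive integers
    ([sign_interpolation]), and up to [exp (- s)] for [e], by Taylor's formula
    ([e_taylor]).  The composite with the sum is a polynomial of degree O(s) in
    [K] functions which do not depend on the frequency.  All these polynomials
    lie in one space of dimension at most [(K + 1) ^ O(s)]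
    ([horner_linear_form]), whence [width_walsh_le] and [width_trig_le].

    The choice [s ~ (log N) ^ (5 / 8)] gives the error [exp (- c log^(1/4) N)]
    in dimension [exp (C log^(5/8) N loglog N) <= exp (C' log^(2/3) N)]
    ([width_parameters]), for both systems. *)

Set Implicit Arguments.
Unset Strict Implicit.
Unset Printing Implicit Defensive.

Import Order.TTheory GRing.Theory Num.Theory.
Import numFieldNormedType.Exports.

Local Open Scope classical_set_scope.
Local Open Scope ring_scope.

(** * Outer measure and widths *)

(** Lebesgue measure is the restriction of an outer measure, so that exceptional
    sets can be compared without any measurability argument. *)
Lemma lebesgue_measure_mono (R : realType) (A B : set R) : A `<=` B ->
  (@lebesgue_measure R A <= lebesgue_measure B)%E.
Proof. exact: (@le_mu_ext _ _ _ (wlength idfun)). Qed.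

Lemma lebesgue_measure_subadd (R : realType) (F : (set R)^nat) n :
  (@lebesgue_measure R (\big[setU/set0]_(i < n) F i)
     <= \sum_(i < n) lebesgue_measure (F i))%E.
Proof.
exact: (@outer_measure_subadditive (ocitv_type R) R (mu_ext (@wlength R idfun))).
Qed.

(** To bound a width from above it suffices to exhibit a spanning family of the
    approximating space. Indexing it by an arbitrary finite type lets the space
    of polynomials be indexed by its monomials. *)
Lemma kolmogorov_width_le (R : realType) (K : nzRingType) (V : lmodType K)
    (X : set V) (nrm : V -> \bar R) (n : nat) (S : set V) (I : finType)
    (b : I -> V) (eps : \bar R) :
  (#|I| <= n)%N ->
  (forall a : I -> K, X (\sum_i a i *: b i)) ->
  (forall x, S x -> exists a : I -> K,
     (nrm (x - \sum_i a i *: b i)%R <= eps)%E) ->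
  (kolmogorov_width X nrm n S <= eps)%E.
Proof.
move=> In Xb Sb.
pose Q := [set v | exists a : I -> K, v = \sum_i a i *: b i].
apply: (@le_trans _ _
  (ereal_sup [set ereal_inf [set nrm (x - y) | y in Q] | x in S])); last first.
  apply: ge_ereal_sup => _ [x Sx <-].
  have [a xa] := Sb x Sx; apply: ge_ereal_inf.
  exists (nrm (x - \sum_i a i *: b i)) => //.
  by exists (\sum_i a i *: b i) => //; exists a.
apply: ereal_inf_lbound; exists Q => //; split; first by move=> _ [a ->].
pose v (j : 'I_n) : V :=
  if insub (val j) is Some i then b (enum_val (i : 'I_#|I|)) else 0.
(* Indices beyond [#|I|] carry the zero vector, so that the family has length
   exactly [n]. *)
have sumE (al : 'I_n -> K) :
    \sum_j al j *: v j = \sum_i al (widen_ord In (enum_rank i)) *: b i.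
  rewrite [RHS](reindex _ (onW_bij _ (@enum_val_bij I))) /=.
  rewrite (bigID (fun j : 'I_n => (j < #|I|)%N)) /= [X in _ + X]big1 ?addr0.
    rewrite big_ord_narrow; apply: eq_bigr => i _.
    by rewrite enum_valK /v /= valK.
  by move=> j jI; rewrite /v insubF ?scaler0//; apply/negbTE.
exists v; apply/seteqP; split => [_ [a ->]|_ [a ->]] /=; last first.
  by exists (fun i => a (widen_ord In (enum_rank i))); rewrite sumE.
exists (fun j : 'I_n =>
    if insub (val j) is Some i then a (enum_val (i : 'I_#|I|)) else 0).
by rewrite sumE; apply: eq_bigr => i _; rewrite /= valK enum_rankK.
Qed.

(** * Polynomials in a linear form *)

Lemma sum_option (A : nmodType) (I : finType) (F : option I -> A) :
  \sum_o F o = F None + \sum_i F (Some i).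
Proof.
rewrite (bigD1 None) //= (reindex_omap Some id) => [|[]//].
by congr (_ + _); apply: eq_bigl => i /=; rewrite eqxx.
Qed.

(** The point is the order of the quantifiers: the coefficients depend only on
    the linear form, and the monomials only on the values [h] of the variables,
    so one space of dimension [(K + 1) ^ D] serves for all the linear forms. *)
Lemma horner_linear_form (A : comNzRingType) (K D : nat)
    (c0 : A) (c : 'I_K -> A) (p : {poly A}) : (size p <= D.+1)%N ->
  exists a : {ffun 'I_D -> option 'I_K} -> A, forall h : 'I_K -> A,
    p.[c0 + \sum_j c j * h j] = \sum_f a f * \prod_i oapp h 1 (f i).
Proof.
move=> pD.
(* The constant function is one of the generators, hence a power e <= D of the
   linear form is a product of exactly D linear forms, D - e of which are 1. *)
pose w (e i : nat) (o : option 'I_K) : A :=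
  if (i < e)%N then oapp c c0 o else (o == None)%:R.
exists (fun f => \sum_(e < D.+1) p`_e * \prod_(i < D) w e i (f i)) => h.
rewrite (horner_coef_wide _ pD).
have -> : c0 + \sum_j c j * h j = \sum_o oapp c c0 o * oapp h 1 o.
  by rewrite sum_option /= mulr1.
under [RHS]eq_bigr do rewrite mulr_suml.
rewrite exchange_big /=; apply: eq_bigr => e _.
under [RHS]eq_bigr do rewrite -mulrA -big_split /=.
rewrite -mulr_sumr -(bigA_distr_bigA (fun (i : 'I_D) o => w e i o * oapp h 1 o)).
congr (_ * _); rewrite -[in LHS](card_ord e) -prodr_const.
rewrite (bigID (fun i : 'I_D => (i < e)%N)) /=.
rewrite [X in _ = _ * X]big1 ?mulr1.
  rewrite (big_ord_narrow (ltn_ord e : (e <= D)%N)) /=.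
  by apply: eq_bigr => i _; apply: eq_bigr => o _; rewrite /w /= ltn_ord.
move=> i ie; rewrite (bigD1 None) //= big1 ?addr0; first by rewrite /w (negbTE ie) mul1r.
by move=> o oN; rewrite /w (negbTE ie) (negbTE oN) mul0r.
Qed.

(** The parity of an integer is not a polynomial, but it agrees with one of
    degree [d] on any [d + 1] consecutive integers. *)
Lemma sign_interpolation (R : numFieldType) (d : nat) :
  exists2 p : {poly R}, (size p <= d.+1)%N &
    forall i, (i <= d)%N -> p.[i%:R] = (-1) ^+ i.
Proof.
elim: d => [|d [p szp pE]].
  exists 1%:P; first by rewrite size_polyC oner_eq0.
  by move=> i; rewrite leqn0 => /eqP ->; rewrite hornerC.
pose q : {poly R} := \prod_(i < d.+1) ('X - i%:R%:P).
have qE (x : R) : q.[x] = \prod_(i < d.+1) (x - i%:R).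
  by rewrite horner_prod; apply: eq_bigr => i _; rewrite hornerXsubC.
have q0 : q.[d.+1%:R] != 0.
  rewrite qE; apply/prodf_neq0 => i _.
  by rewrite subr_eq0 eqr_nat neq_ltn ltn_ord orbT.
pose t := ((-1) ^+ d.+1 - p.[d.+1%:R]) / q.[d.+1%:R].
exists (p + t *: q) => [|i].
  rewrite (leq_trans (size_polyD _ _))// geq_max (leq_trans szp)//=.
  rewrite (leq_trans (size_scale_leq _ _))// size_prod_XsubC.
  by rewrite -[index_enum _]enumT size_enum_ord.
rewrite leq_eqVlt hornerD hornerZ => /predU1P[->|id].
  by rewrite divfK// addrCA subrr addr0.
rewrite pE// (_ : q.[_] = 0) ?mulr0 ?addr0//.
by rewrite qE (bigD1 (Ordinal id)) //= subrr mul0r.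
Qed.

(** * Concentration of sums over binary digits *)

Lemma nat_digit_half (m j : nat) : nat_digit m j.+1 = nat_digit m./2 j.
Proof. by rewrite /nat_digit expnS -divn2 divnMA. Qed.

(** Independence of the binary digits of a uniform integer below [2 ^ K]: the
    expectation of a product of functions of the digits is the product of the
    expectations. *)
Lemma sum_prod_bits (A : comNzRingType) (g : nat -> bool -> A) (K : nat) :
  \sum_(a < 2 ^ K) \prod_(i < K) g i (nat_digit a i)
    = \prod_(i < K) (g i false + g i true).
Proof.
elim: K g => [|K IH] g; first by rewrite big_ord1 !big_ord0.
rewrite big_ord_recl -(IH (fun i => g i.+1)) mulr_sumr.
have digit0 a : nat_digit a 0 = odd a by rewrite /nat_digit expn0 divn1.
rewrite -(big_mkord xpredT (fun a => \prod_(i < K.+1) g i (nat_digit a i))).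
rewrite -(big_mkord xpredT
  (fun a => (g 0%N false + g 0%N true) * \prod_(i < K) g i.+1 (nat_digit a i))).
(* The integers below [2 m] are grouped in pairs [2 a], [2 a + 1]. *)
rewrite expnS mul2n; elim: (2 ^ K)%N => [|m IHm]; first by rewrite !big_geq.
rewrite doubleS !big_nat_recr //= IHm -addrA; congr (_ + _).
rewrite !big_ord_recl /= !digit0 /= odd_double /= mulrDl.
by congr (_ * _ + _ * _); apply: eq_bigr => i _; rewrite nat_digit_half /=
  ?uphalf_double ?half_double.
Qed.

Lemma truncn_divn (R : archiRealFieldType) (x : R) (m : nat) : (0 < m)%N ->
  Num.truncn (x / m%:R) = (Num.truncn x %/ m)%N.
Proof.
move=> m0; have m0R : (0 : R) < m%:R by rewrite ltr0n.
have [x0|x0] := leP 0 x; last first.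
  rewrite !truncn_floor !leNgt pmulr_llt0 ?invr_gt0// x0.
  by rewrite div0n.
have /andP[ax xa] := truncn_itv x0.
apply: truncn_def; rewrite ler_pdivlMr// ltr_pdivrMr// -!natrM.
rewrite (le_trans _ ax) ?ler_nat ?leq_trunc_div//=.
by rewrite (lt_le_trans xa)// ler_nat ltn_ceil.
Qed.

(** The first [K] digits of [y] are those of the index of the dyadic interval of
    length [2 ^ - K] that contains [y], in the opposite order. *)
Lemma real_digit_nat_digit (R : realType) (K j : nat) (y : R) : (j <= K)%N ->
  real_digit y j = nat_digit (Num.truncn (2 ^+ K * y)) (K - j).
Proof.
move=> jK; rewrite /nat_digit -truncn_divn ?expn_gt0// natrX.
rewrite -[in 2 ^+ K](subnKC jK) exprD.
by rewrite mulrAC mulfK ?expf_neq0 ?pnatr_eq0// /real_digit.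
Qed.

Lemma measurable_real_digit (R : realType) (D : set R) (j : nat) : measurable D ->
  measurable_fun D (fun y => (real_digit y j)%:R : R).
Proof.
move=> mD.
have mt (s : R) : 0 < s ->
    measurable_fun D (fun y => (Num.truncn (s * y))%:R : R).
  move=> s0; apply: nondecreasing_measurable => // x y xy.
  by rewrite ler_nat le_truncn// ler_pM2l.
(* A digit is a difference of monotone functions: the parity of [t] is
   [t - 2 (t / 2)]. *)
rewrite (_ : (fun y => _) = (fun y : R => (Num.truncn (2 ^+ j * y))%:R
    - 2 * (Num.truncn (2 ^+ j / 2 * y))%:R)).
  apply: measurable_funB; first by apply: mt; rewrite exprn_gt0.
  by apply: measurable_funM => //; apply: mt; rewrite divr_gt0 ?exprn_gt0.
apply/funext => y; rewrite mulrAC truncn_divn// divn2 /real_digit.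
rewrite -[in (Num.truncn (2 ^+ j * y))%:R](odd_double_half (Num.truncn _)).
by rewrite natrD -muln2 natrM [_ * 2]mulrC addrK.
Qed.

(** The subgaussian bound for the moment generating function of a random sign.
    The constant 2 in the exponent is not optimal; it allows a proof from
    [1 + t <= expR t] only. *)
Lemma expRD_opp_le (R : realType) (x : R) : `|x| <= 1 / 2 ->
  expR x + expR (- x) <= 2 * expR (2 * x ^+ 2).
Proof.
rewrite ler_norml => /andP[x1 x2].
have inv_le (t : R) : t <= 1 / 2 -> expR t <= (1 - t)^-1.
  move=> t12; rewrite -[expR t]invrK -expRN lef_pV2 ?posrE ?expR_gt0//; last lra.
  exact: expR_ge1Dx.
have h1 := inv_le x ltac:(lra); have h2 := inv_le (- x) ltac:(lra).
apply: (le_trans (lerD h1 h2)).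
have sum_inv : (1 - x)^-1 + (1 - - x)^-1 = 2 / (1 - x ^+ 2).
  by field; apply/and3P; split; apply/eqP; nra.
rewrite sum_inv ler_pM2l// -[expR _]invrK -expRN lef_pV2 ?posrE ?expR_gt0//; last nra.
have h3 : expR (- (2 * x ^+ 2)) <= (1 + 2 * x ^+ 2)^-1.
  rewrite expRN lef_pV2 ?posrE ?expR_gt0 ?expR_ge1Dx//; nra.
apply: (le_trans h3); rewrite -[_^-1]mul1r ler_pdivrMr; last nra.
have [t0 t1] : 0 <= x ^+ 2 /\ x ^+ 2 <= 1 / 4 by split; nra.
nra.
Qed.

(** Chernoff's method: [|X| >= u] forces
    [expR (l X) + expR (- l X) >= expR (l u)], and the sum of the left hand side
    over all integers factors over the digits. *)
Lemma hoeffding_count (R : realType) (K : nat) (c : nat -> R) (u : R) :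
  (forall i, `|c i| <= 1) -> 0 <= u ->
  (#|[set a : 'I_(2 ^ K) |
      u <= `|\sum_(i < K) c i * (-1) ^+ nat_digit a i|]%SET|%:R : R)
  <= 2 ^+ K * (2 * expR (- (u ^+ 2 / (8 * K%:R)))).
Proof.
move=> c1 u0; set B := finset _.
have [uK|Ku] := leP u K%:R; last first.
  have -> : B = finset.set0.
    apply/setP => a; rewrite !inE leNgt; apply/negbTE; rewrite negbK.
    apply: le_lt_trans Ku; apply: (le_trans (ler_norm_sum _ _ _)).
    rewrite -[leRHS]mulr1 mulr_natl -[in leRHS](card_ord K) -sumr_const.
    by apply: ler_sum => i _; rewrite normrM normrX normrN normr1 expr1n mulr1.
  by rewrite cards0 mulr_ge0 ?exprn_ge0// mulr_ge0 ?expR_ge0.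
(* This value of [l] minimizes [- l u + 2 l^2 K]. *)
pose l := u / (4 * K%:R).
have [K0|K0] := posnP K.
  subst K; rewrite mulr0 invr0 mulr0 oppr0 expR0 mulr1 mul1r.
  have B1 : (#|B| <= 1)%N by rewrite -[leqRHS](card_ord 1) max_card.
  by rewrite ler_nat (leq_trans B1).
have Kp : (0 : R) < K%:R by rewrite ltr0n.
have l0 : 0 <= l by rewrite divr_ge0 ?mulr_ge0.
have l12 : l <= 1 / 2.
  rewrite ler_pdivrMr ?mulr_gt0//; nra.
pose X (a : nat) : R := \sum_(i < K) c i * (-1) ^+ nat_digit a i.
have mgf (t : R) : `|t| = l ->
    \sum_(a < 2 ^ K) expR (t * X a) <= 2 ^+ K * expR (2 * l ^+ 2 * K%:R).
  move=> tl; rewrite expRM_natr -exprMn.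
  under eq_bigr do rewrite /X mulr_sumr expR_sum.
  rewrite (sum_prod_bits (fun i b => expR (t * (c i * (-1) ^+ b)))).
  have <- : \prod_(i < K) (2 * expR (2 * l ^+ 2)) = (2 * expR (2 * l ^+ 2)) ^+ K.
    by rewrite prodr_const card_ord.
  apply: ler_prod => i _; rewrite addr_ge0 ?expR_ge0//=.
  rewrite expr0 expr1 mulr1 mulrN1 mulrN.
  have tc : `|t * c i| <= l by rewrite normrM tl ler_piMr.
  apply: (le_trans (expRD_opp_le (le_trans tc l12))).
  rewrite ler_pM2l// ler_expR ler_pM2l// -real_normK ?num_real//.
  by rewrite lerXn2r ?nnegrE.
have -> : - (u ^+ 2 / (8 * K%:R)) = - (l * u) + 2 * l ^+ 2 * K%:R.
  by rewrite /l; field; rewrite lt0r_neq0.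
rewrite expRD expRN -sum1_card natr_sum.
have le_sum : \sum_(a in B) 1 <=
    (expR (l * u))^-1 * \sum_(a < 2 ^ K) (expR (l * X a) + expR (- l * X a)).
  rewrite mulr_sumr big_mkcond /=; apply: ler_sum => a _.
  case: ifPn => [|_]; last by rewrite mulr_ge0 ?invr_ge0 ?addr_ge0 ?expR_ge0.
  rewrite inE => uX; rewrite -ler_pdivrMl ?invr_gt0 ?expR_gt0// invrK mulr1.
  apply: (@le_trans _ _ (expR (l * `|X a|))).
    by rewrite ler_expR ler_wpM2l.
  have [X0|X0] := leP 0 (X a).
    by rewrite ger0_norm// lerDl expR_ge0.
  by rewrite ltr0_norm// mulrN -mulNr lerDr expR_ge0.
apply: (le_trans le_sum); rewrite big_split /=.
have hp := mgf l (ger0_norm l0); have hn : `|- l| = l by rewrite normrN ger0_norm.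
have {}hn := mgf _ hn.
have E0 : 0 <= (expR (l * u))^-1 by rewrite invr_ge0 expR_ge0.
have := ler_wpM2l E0 (lerD hp hn); set E := _^-1; set G := expR _.
by move=> /le_trans; apply; rewrite le_eqVlt; apply/orP; left; apply/eqP; ring.
Qed.

(** The sum depends only on the dyadic interval of length [2 ^ - K] that contains
    [y], so the exceptional set is a union of such intervals, counted by
    [hoeffding_count]. *)
Lemma hoeffding_digits (R : realType) (K : nat) (c : nat -> R) (u : R) :
  (forall i, `|c i| <= 1) -> 0 <= u ->
  (@lebesgue_measure R (`[0%R, 1%R]%classic `&`
     [set y | u <= `|\sum_(i < K) c i * (-1) ^+ real_digit y i.+1|]%R)
   <= (2 * expR (- (u ^+ 2 / (8 * K%:R))))%:E)%E.
Proof.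
move=> c1 u0.
pose c' i := c (K - i.+1)%N.
pose bad (a : nat) := u <= `|\sum_(i < K) c' i * (-1) ^+ nat_digit a i|.
pose I (a : nat) : set R := `[a%:R / 2 ^+ K, a.+1%:R / 2 ^+ K[%classic.
pose F (a : nat) : set R := if bad a then I a else set0.
have p2 : (0 : R) < 2 ^+ K by rewrite exprn_gt0.
have muF a : lebesgue_measure (F a) = (if bad a then (2 ^+ K)^-1 else 0)%:E.
  rewrite /F; case: ifPn => _; last by rewrite measure0.
  rewrite lebesgue_measure_itv /= lte_fin ltr_pM2r ?invr_gt0// ltr_nat ltnSn.
  by rewrite -EFinD -mulrBl -natrB// subSnn mul1r.
(* At the right end point 1 all the digits vanish; it is put aside. *)
apply: (@le_trans _ _ (lebesgue_measure
    (\big[setU/set0]_(a < 2 ^ K) F a `|` [set 1]))).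
  apply: lebesgue_measure_mono => y [/=]; rewrite in_itv/= => /andP[y0 y1] uy.
  move: y1; rewrite le_eqVlt => /predU1P[->|y1]; [by right|left].
  have ky0 : 0 <= 2 ^+ K * y by rewrite mulr_ge0// ltW.
  have /andP[ay ya] := truncn_itv ky0; set a := Num.truncn _ in ay ya.
  have aK : (a < 2 ^ K)%N.
    by rewrite truncn_lt_nat// natrX gtr_pMr.
  rewrite -bigcup_mkord; exists a => //=; rewrite /F.
  have -> : bad a.
    rewrite /bad (reindex_inj rev_ord_inj) /=.
    rewrite (eq_bigr (fun i : 'I_K => c i * (-1) ^+ real_digit y i.+1))// => i _.
    by rewrite (real_digit_nat_digit _ (ltn_ord i)) /c' subnSK// subKn// ltnW.
  by rewrite /I /= in_itv /= ler_pdivrMr// ltr_pdivlMr// ![y * _]mulrC ay.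
apply: (le_trans (outer_measureU2 (mu_ext (@wlength R idfun)) _ _)).
rewrite -[X in (_ + X <= _)%E]/(lebesgue_measure [set 1]).
rewrite -[X in (X + _ <= _)%E]/(lebesgue_measure (\big[setU/set0]_(a < 2 ^ K) F a)).
rewrite lebesgue_measure_set1 adde0 (le_trans (lebesgue_measure_subadd _ _))//.
under eq_bigr do rewrite muF.
rewrite sumEFin lee_fin -big_mkcond /= sumr_const.
rewrite -[leLHS]mulr_natl ler_pdivrMr// mulrC.
apply: le_trans (hoeffding_count K (c := c') _ u0) => [|i]; last exact: c1.
by rewrite ler_nat subset_leq_card//; apply/fintype.subsetP => a; rewrite inE.
Qed.

(** * The Walsh system *)

Lemma nat_digit_large (m j : nat) : (m < 2 ^ j)%N -> nat_digit m j = false.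
Proof. by move=> mj; rewrite /nat_digit divn_small. Qed.

Lemma walsh_digits (R : realType) (K m : nat) (y : R) : (m < 2 ^ K)%N ->
  walsh m y = (-1) ^+ (\sum_(j < K) nat_digit m j * real_digit y j.+1)%N.
Proof.
move=> mK; rewrite /walsh big_add1 /=; congr (_ ^+ _).
have extend M M' : (m < 2 ^ M)%N -> (M <= M')%N ->
    (\sum_(0 <= j < M') nat_digit m j * real_digit y j.+1
       = \sum_(0 <= j < M) nat_digit m j * real_digit y j.+1)%N.
  move=> mM MM'; rewrite (big_cat_nat (leq0n M) MM') /= [X in (_ + X)%N]big_nat_cond.
  rewrite [X in (_ + X)%N]big1 ?addn0// => j /andP[/andP[Mj _] _].
  by rewrite nat_digit_large// (leq_trans mM)// leq_exp2l.
rewrite -(extend m (maxn m K) (ltn_expl m (isT : (1 < 2)%N)) (leq_maxl m K)).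
by rewrite (extend K _ mK (leq_maxr m K)) big_mkord.
Qed.

Lemma card_monomials (D K : nat) :
  #|{: {ffun 'I_D -> option 'I_K}}| = (K.+1 ^ D)%N.
Proof. by rewrite card_ffun card_option !card_ord. Qed.

(** With [w] the number of digits 1 of [m] and [S y] the number of places where
    [m] and [y] both have a digit 1, the random sum [w - 2 S y] is smaller than
    [s] outside the exceptional set. There [S y] lies in a window of [s + 1]
    integers that depends only on [m], and interpolation is exact. *)
Lemma width_walsh_le (R : realType) (K s n N : nat) :
  (N < 2 ^ K)%N -> (K.+1 ^ s <= n)%N ->
  (width_LH_unit_interval n (@walsh_system R N)
   <= (2 * expR (- (s%:R ^+ 2 / (8 * K%:R))))%:E)%E.
Proof.
move=> NK sn.
pose d (y : R) (j : 'I_K) : R := (real_digit y j.+1)%:R.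
pose b (f : {ffun 'I_s -> option 'I_K}) : R -> R^o :=
  fun y => \prod_i oapp (d y) 1 (f i).
apply: (@kolmogorov_width_le _ _ _ _ _ _ _ _ b); first by rewrite card_monomials.
  move=> a; rewrite /LH_unit_interval_space /= fct_sumE.
  apply: measurable_sum => f; apply: measurable_funM => //.
  apply: measurable_prod => i _; case: (f i) => [j|] //=.
  exact: measurable_real_digit.
move=> _ [m /= /andP[_ mN] <-].
have mK : (m < 2 ^ K)%N by apply: leq_ltn_trans NK.
pose w := (\sum_(j < K) nat_digit m j)%N.
pose S (y : R) := (\sum_(j < K) nat_digit m j * real_digit y j.+1)%N.
(* The left end of the window; the subtraction is truncated at 0, which is a
   lower bound for [S y] anyway. *)
pose o := ((w - s)./2)%N.
have [p szp pE] := sign_interpolation R s.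
have [|a aE] := @horner_linear_form R K s (- o%:R)
    (fun j => (nat_digit m j)%:R) ((-1) ^+ o *: p).
  by rewrite (leq_trans (size_scale_leq _ _)).
exists a.
have digit_le1 i : `|(nat_digit m i)%:R : R| <= 1.
  by case: nat_digit; rewrite ?normr1 ?normr0.
have := @hoeffding_digits R K (fun j => (nat_digit m j)%:R) s%:R.
move=> /(_ digit_le1 (ler0n _ _)); apply: le_trans.
apply: lebesgue_measure_mono => y [/= y01 neq]; split=> //.
rewrite leNgt; apply/negP => lt_s; move/negP: neq; apply.
rewrite subr_eq0; apply/eqP; rewrite fct_sumE (walsh_digits _ mK) -/(S y).
rewrite -[RHS](aE (d y)).
have SE : \sum_(j < K) (nat_digit m j)%:R * d y j = (S y)%:R.
  by rewrite natr_sum; apply: eq_bigr => j _; rewrite natrM.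
have XE : \sum_(j < K) (nat_digit m j)%:R * (-1) ^+ real_digit y j.+1
    = w%:R - (S y).*2%:R :> R.
  rewrite -muln2 natrM -SE mulr_suml natr_sum -sumrB; apply: eq_bigr => j _.
  by rewrite /d; case: real_digit; rewrite /= ?expr1 ?expr0; ring.
have [oS So] : (o <= S y)%N /\ (S y - o <= s)%N.
  move: lt_s; rewrite XE ltr_norml => /andP[].
  rewrite ltrBrDr addrC 2!ltrBlDr -!natrD !ltr_nat /o.
  by clearbody w; move: (S y) => k; lia.
rewrite SE hornerZ addrC -natrB// pE// -exprD subnKC//.
Qed.

(** * Taylor polynomials of the exponential *)

Lemma expR1_le4 (R : realType) : expR (1 : R) <= 4.
Proof.
have h : expR (1 / 2 : R) <= 2.
  rewrite -[expR _]invrK -expRN invf_ple ?posrE ?expR_gt0//.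
  by apply: le_trans (expR_ge1Dx _); lra.
have -> : (1 : R) = 1 / 2 + 1 / 2 by lra.
rewrite expRD; have := expR_ge0 (1 / 2 : R); nra.
Qed.

(** A tail of a series dominated by the exponential series: for [k >= D] the
    factor [4 ^ k >= expR D] can be inserted in each term, at the price of
    [expR (- D)] and of replacing [|x|] by [4 |x|]. The bound is small as soon as
    [D] is a large multiple of [|x|]. *)
Lemma exp_tail_le (R : realType) (x : R) (u : R^nat) (D : nat) :
  (forall k, `|u k| <= exp_coeff `|x| k) -> cvg (series u @ \oo) ->
  `|limn (series u) - series u D| <= expR (4 * `|x| - D%:R).
Proof.
move=> ux cu.
have le_tail (n : nat) : (D <= n)%N ->
    `|series u n - series u D| <= expR (4 * `|x| - D%:R).
  move=> Dn; rewrite sub_series_geq//; apply: (le_trans (ler_norm_sum _ _ _)).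
  have le1 : \sum_(D <= k < n) `|u k|
      <= \sum_(D <= k < n) expR (- D%:R) * exp_coeff (4 * `|x|) k.
    apply: ler_sum_nat => k /andP[Dk _]; apply: (le_trans (ux k)).
    rewrite /exp_coeff /= mulrA ler_pM2r ?invr_gt0 ?ltr0n ?fact_gt0//.
    rewrite exprMn mulrA ler_peMl ?exprn_ge0//.
    rewrite expRN -ler_pdivrMl ?invr_gt0 ?expR_gt0// invrK mulr1.
    rewrite -[D%:R]mulr1 expRM_natl; apply: (@le_trans _ _ (4 ^+ D)).
      by rewrite lerXn2r ?nnegrE ?expR_ge0 ?expR1_le4.
    by rewrite ler_weXn2l// ler1n.
  apply: (le_trans le1); rewrite -mulr_sumr addrC expRD ler_pM2l ?expR_gt0//.
  apply: (@le_trans _ _ (series (exp_coeff (4 * `|x|)) n)).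
    rewrite -(@sub_series_geq _ _ D n)// gerBl.
    by apply: sumr_ge0 => k _; rewrite divr_ge0 ?exprn_ge0 ?mulr_ge0.
  apply: nondecreasing_cvgn_le; last exact: is_cvg_series_exp_coeff.
  apply: nondecreasing_series => k _ _.
  by rewrite divr_ge0 ?exprn_ge0 ?mulr_ge0.
have cB : `|series u n - series u D| @[n --> \oo]
    --> `|limn (series u) - series u D|.
  by apply: cvg_norm; apply: cvgB => //; exact: cvg_cst.
rewrite -(cvg_lim _ cB)//; apply: limr_le; first by apply/cvg_ex; eexists; exact: cB.
by near=> n; apply: le_tail; near: n; exact: nbhs_infty_ge.
Unshelve. all: by end_near. Qed.

Lemma e_add (R : realType) (x y : R) : e (x + y) = e x * e y.
Proof.
rewrite /e mulrDr cosD sinD; apply/eqP; rewrite eq_complex /=.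
by apply/andP; split; apply/eqP; ring.
Qed.

Lemma e_nat (R : realType) (n : nat) : e (n%:R : R) = 1.
Proof.
have -> : e (n%:R : R) = Complex (cos (pi *+ 2 *+ n)) (sin (pi *+ 2 *+ n)).
  by rewrite /e mulr_natr mulr_natl.
have := periodicn (@cosD2pi R) n 0; have := periodicn (@sinD2pi R) n 0.
by rewrite !add0r cos0 sin0 => -> ->.
Qed.

Lemma e_int (R : realType) (z : int) : e (z%:~R : R) = 1.
Proof.
case: z => n; first exact: e_nat.
have := e_add (n.+1%:R : R) (- n.+1%:R); rewrite subrr (e_nat _ 0) e_nat mul1r.
by rewrite NegzE mulrNz.
Qed.

Lemma normc_e (R : realType) (x : R) : Normc.normc (e x) = 1.
Proof. by rewrite /= cos2Dsin2 sqrtr1. Qed.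

Lemma normc_le_abs (R : realType) (a b : R) :
  Normc.normc (Complex a b) <= `|a| + `|b|.
Proof.
rewrite /= -[leRHS]ger0_norm ?addr_ge0// -sqrtr_sqr ler_wsqrtr//.
rewrite -[a ^+ 2]real_normK ?num_real// -[b ^+ 2]real_normK ?num_real//.
have := normr_ge0 a; have := normr_ge0 b; nra.
Qed.

(** The factor [32 = 4 * 8] comes from [exp_tail_le] and [2 pi <= 8]. *)
Lemma e_taylor (R : realType) (D : nat) :
  exists2 p : {poly R[i]}, (size p <= D)%N &
    forall v : R, Normc.normc (e v - p.[Complex v 0]) <=
      2 * expR (32 * `|v| - D%:R).
Proof.
pose t (k : nat) : R[i] :=
  Complex ((2 * pi) ^+ k * ((~~ odd k)%:R * (-1) ^+ k./2 / k`!%:R))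
          ((2 * pi) ^+ k * ((odd k)%:R * (-1) ^+ k.-1./2 / k`!%:R)).
exists (\poly_(k < D) t k); first exact: size_poly.
move=> v; set x := 2 * pi * v.
have -> : (\poly_(k < D) t k).[Complex v 0] =
    Complex (series (cos_coeff x) D) (series (sin_coeff x) D).
  rewrite horner_poly /series /=; elim: D => [|D IH].
    by rewrite big_ord0 !big_geq.
  rewrite big_ord_recr !big_nat_recr //= {}IH.
  have -> : Complex v 0 ^+ D = Complex (v ^+ D) 0 by rewrite !complexr0 rmorphXn.
  rewrite /t /cos_coeff /sin_coeff /x /=; simpc.
  by congr Complex; congr (_ + _); rewrite -?exprnP !exprMn; ring.
have -> : e v - Complex (series (cos_coeff x) D) (series (sin_coeff x) D) =
  Complex (cos x - series (cos_coeff x) D) (sin x - series (sin_coeff x) D) by [].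
have le_x : `|x| <= 8 * `|v|.
  rewrite normrM ler_wpM2r// ger0_norm ?mulr_ge0 ?pi_ge0//.
  by have := @pihalf_lt2 R; lra.
clearbody x; apply: (le_trans (normc_le_abs _ _)).
have le_exp : expR (4 * `|x| - D%:R) <= expR (32 * `|v| - D%:R).
  by rewrite ler_expR lerD2r; lra.
have cosx : `|cos x - series (cos_coeff x) D| <= expR (4 * `|x| - D%:R).
  rewrite unlock; apply: exp_tail_le; last exact: is_cvg_series_cos_coeff.
  move=> k; rewrite /exp_coeff /cos_coeff /= !normrM normfV normr_nat normrX.
  rewrite normrX normrN normr1 expr1n mulr1 normr_nat.
  by case: odd => /=; rewrite ?mulr0n ?mulr1n ?mul0r ?mul1r// divr_ge0 ?exprn_ge0.
have sinx : `|sin x - series (sin_coeff x) D| <= expR (4 * `|x| - D%:R).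
  rewrite unlock; apply: exp_tail_le; last exact: is_cvg_series_sin_coeff.
  move=> k; rewrite /exp_coeff /sin_coeff /= !normrM normfV normr_nat normrX.
  rewrite normrX normrN normr1 expr1n mulr1 normr_nat.
  by case: odd => /=; rewrite ?mulr0n ?mulr1n ?mul0r ?mul1r// divr_ge0 ?exprn_ge0.
by rewrite [leRHS]mulr_natl mulr2n lerD// (le_trans _ le_exp).
Qed.

(** * Sawtooth functions and binary digits *)

Definition sawtooth (R : realType) (z : R) : R := z - (Num.floor z)%:~R - 1 / 2.

Lemma sawtoothDz (R : realType) (z : R) (m : int) :
  sawtooth (z + m%:~R) = sawtooth z.
Proof. by rewrite /sawtooth floorDrz ?intr_int// intrD intrKfloor; ring. Qed.

Lemma norm_sawtooth_le (R : realType) (z : R) : `|sawtooth z| <= 1 / 2.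
Proof.
rewrite /sawtooth ler_norml; have := floor_itv z; rewrite intrD.
by move=> /andP[? ?]; apply/andP; split; lra.
Qed.

Lemma measurable_sawtooth (R : realType) (s : R) : 0 <= s ->
  measurable_fun setT (fun x : R => sawtooth (s * x)).
Proof.
move=> s0; apply: measurable_funB => //; apply: measurable_funB.
  exact: measurable_funM.
by apply: nondecreasing_measurable => // x y xy; rewrite ler_int le_floor// ler_wpM2l.
Qed.

(** Doubling shifts the binary expansion: the first digit of the fractional part
    of [z] is the parity of the integer part of [2 z]. *)
Lemma sawtooth_double (R : realType) (z : R) : 0 <= z ->
  sawtooth z = (sawtooth (2 * z) - (-1) ^+ odd (Num.truncn (2 * z)) / 2) / 2.
Proof.
move=> z0; have fl (x : R) : 0 <= x -> (Num.floor x)%:~R = (Num.truncn x)%:R :> R.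
  by move=> x0; rewrite (floor_def (m := Num.truncn x))// -PoszD addn1 truncn_itv.
rewrite /sawtooth !fl ?mulr_ge0//.
have -> : Num.truncn z = (Num.truncn (2 * z))./2.
  by rewrite -divn2 -truncn_divn// mulrAC divff ?mul1r.
set t := Num.truncn _; rewrite -[in t%:R](odd_double_half t) natrD -muln2 natrM.
by case: odd; rewrite /= ?expr1 ?expr0; field.
Qed.

(** [carry R b i] is the number [sum_(j < i) b_j 2 ^ (j - i)], the total weight
    with which the [i]-th digit of [x] enters the fractional parts of
    [2 ^ j x], [j < i], selected by [b]. *)
Fixpoint carry (R : realType) (b : nat -> bool) (i : nat) : R :=
  if i is j.+1 then (carry R b j + (b j)%:R) / 2 else 0.

Lemma carry_itv (R : realType) (b : nat -> bool) (i : nat) :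
  0 <= carry R b i <= 1.
Proof.
elim: i => [|i IH] /=; first by rewrite lexx ler01.
by move: IH => /andP[? ?]; case: (b i) => /=; apply/andP; split; lra.
Qed.

(** The sawtooth functions [sawtooth (2 ^ j * x)] are not independent, but by
    [sawtooth_double] each one is half a random sign plus half the next one.
    Unrolling this relation turns their sum into a sum of independent signs, with
    weights in [0, 1], and a bounded remainder. *)
Lemma sum_sawtooth_digits (R : realType) (b : nat -> bool) (K : nat) (x : R) :
  0 <= x ->
  \sum_(j < K) (b j)%:R * sawtooth (2 ^+ j * x) =
    carry R b K * sawtooth (2 ^+ K * x)
    - (\sum_(j < K) carry R b j.+1 * (-1) ^+ real_digit x j.+1) / 2.
Proof.
move=> x0; elim: K => [|K IH]; first by rewrite !big_ord0 !mul0r subr0.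
rewrite !big_ord_recr /= {}IH (sawtooth_double (z := 2 ^+ K * x)) ?mulr_ge0 ?exprn_ge0//.
have -> : 2 * (2 ^+ K * x) = 2 ^+ K.+1 * x by rewrite mulrA exprS.
by rewrite /real_digit; field.
Qed.

Lemma sum_nat_digit (R : pzSemiRingType) (K m : nat) : (m < 2 ^ K)%N ->
  \sum_(j < K) (nat_digit m j)%:R * 2 ^+ j = m%:R :> R.
Proof.
elim: K m => [|K IH] m; first by case: m => // _; rewrite big_ord0.
rewrite expnS mul2n => mK; rewrite big_ord_recl expr0 mulr1.
under eq_bigr do rewrite /= nat_digit_half exprSr mulrA.
rewrite -mulr_suml IH -?natrM ?muln2; last by rewrite -divn2 ltn_divLR// muln2.
by rewrite -natrD /nat_digit expn0 divn1 odd_double_half.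
Qed.

(** * The trigonometric system *)

Lemma L0_norm_le (R : realType) (D : set R) (f : R -> R[i]) (eps : R) :
  (@lebesgue_measure R (D `&` [set x | eps < Normc.normc (f x)]%R) <= eps%:E)%E ->
  (L0_norm (@lebesgue_measure R) D f <= eps%:E)%E.
Proof.
move=> le_eps; apply: ge_ereal_sup => _ [t [t0 t_le] <-].
rewrite leNgt; apply/negP => eps_t.
have := lt_le_trans eps_t t_le; rewrite ltNge => /negP; apply.
apply: le_trans le_eps; apply: lebesgue_measure_mono => x [Dx tx]; split=> //.
by apply: lt_le_trans tx; rewrite -lte_fin.
Qed.

(** Writing [|k|] in base 2, each [2 ^ j * x] is an integer plus [1 / 2] plus its
    sawtooth; the integers do not change the value of [e], and the halves are
    collected in the first factor, which does not depend on [x]. *)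
Lemma e_binary_phase (R : realType) (K : nat) (k : int) (x : R) :
  (`|k| < 2 ^ K)%N ->
  e (k%:~R * x) = e ((sgz k)%:~R * ((\sum_(j < K) nat_digit `|k| j)%N%:R / 2))
    * e ((sgz k)%:~R * \sum_(j < K) (nat_digit `|k| j)%:R * sawtooth (2 ^+ j * x)).
Proof.
move=> kK; pose z : int := sgz k *
  \sum_(j < K) (nat_digit `|k| j)%:R * Num.floor (2 ^+ j * x).
rewrite -[RHS]mulr1 -(e_int R z) -!e_add; congr e.
rewrite {1}[k]intEsg intrM -mulrA -[_%:~R * x]/(`|k|%:R * x).
rewrite -(sum_nat_digit R kK) /z intrM -!mulrDr; congr (_ * _).
rewrite natr_sum rmorph_sum !mulr_suml -!big_split /=; apply: eq_bigr => j _.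
by rewrite intrM /sawtooth rmorph_nat; field.
Qed.

Lemma sum_sawtooth_lt (R : realType) (K m s : nat) (x : R) : 0 <= x -> (0 < s)%N ->
  `|\sum_(j < K) carry R (nat_digit m) j.+1 * (-1) ^+ real_digit x j.+1| < s%:R ->
  `|\sum_(j < K) (nat_digit m j)%:R * sawtooth (2 ^+ j * x)| <= s%:R.
Proof.
move=> x0 s0; rewrite sum_sawtooth_digits//; set X := \sum_(j < K) _ => Xs.
have s1 : (1 : R) <= s%:R by rewrite ler1n.
apply: (le_trans (ler_normB _ _)); rewrite !normrM.
have /andP[c0 c1] := carry_itv R (nat_digit m) K.
have := norm_sawtooth_le (2 ^+ K * x); rewrite (ger0_norm c0).
have := normr_ge0 (sawtooth (2 ^+ K * x)); rewrite (@ger0_norm _ 2^-1)//; nra.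
Qed.

(** The degree [40 s] makes the Taylor error at most [2 expR (- 8 s)] on the
    window [|Psi| <= s], and [s <= 16 K] ensures that this does not exceed the
    measure of the exceptional set. *)
Lemma width_trig_le (R : realType) (K s n N : nat) :
  (N < 2 ^ K)%N -> (0 < s <= 16 * K)%N -> (K.+1 ^ (40 * s) <= n)%N ->
  (width_L0_torus n (@trig_system R N)
   <= (2 * expR (- (s%:R ^+ 2 / (8 * K%:R))))%:E)%E.
Proof.
move=> NK /andP[s0 sK] sn; set eps := 2 * expR _.
pose h (x : R) (j : 'I_K) : R := sawtooth (2 ^+ j * x).
pose mono (f : {ffun 'I_(40 * s) -> option 'I_K}) (x : R) : R :=
  \prod_i oapp (h x) 1 (f i).
pose b f : R -> R[i]^o := fun x => Complex (mono f x) 0.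
have bE (f : {ffun 'I_(40 * s) -> option 'I_K}) x :
    b f x = \prod_i oapp (fun j => Complex (h x j) 0) 1 (f i) :> R[i].
  rewrite /b complexr0 /mono rmorph_prod; apply: eq_bigr => i _.
  by case: (f i).
apply: (@kolmogorov_width_le _ _ _ _ _ _ _ _ b); first by rewrite card_monomials.
  move=> a.
  (* The basis functions are real, hence the real and imaginary parts of their
   combinations are real combinations of them. *)
  have aE x : (\sum_f a f *: b f) x =
      Complex (\sum_f complex.Re (a f) * mono f x)
              (\sum_f complex.Im (a f) * mono f x).
    rewrite fct_sumE.
    have sumC (I : finType) (u v : I -> R) : \sum_i Complex (u i) (v i) =
        Complex (\sum_i u i) (\sum_i v i).
      by apply: (big_ind3 (fun z x y => z = Complex x y)) => // ? ? ? ? ? ? -> ->.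
    rewrite -sumC; apply: eq_bigr => f _.
    change (a f * b f x = Complex (complex.Re (a f) * mono f x) (complex.Im (a f) * mono f x)).
    by case: (a f) => u v; rewrite /b; simpc.
  have mmono f : measurable_fun setT (mono f).
    apply: measurable_prod => i _; case: (f i) => [j|] //=.
    by apply: measurable_sawtooth; rewrite exprn_ge0.
  split=> [x||].
  - have per f : mono f (x + 1) = mono f x.
      apply: eq_bigr => i _; case: (f i) => //= j.
      by rewrite /h mulrDr mulr1 -[RHS](sawtoothDz _ (2 ^ j)%N) -pmulrn natrX.
    by rewrite !aE; congr Complex; apply: eq_bigr => f _; rewrite per.
  - under eq_fun do rewrite aE /=.
    by apply: measurable_sum => f; apply: measurable_funM.
  - under eq_fun do rewrite aE /=.
    by apply: measurable_sum => f; apply: measurable_funM.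
move=> _ [k /= kN <-].
have kK : (`|k| < 2 ^ K)%N.
  apply: leq_ltn_trans NK; lia.
set m := `|k|%N in kK.
have [p szp pE] := e_taylor R (40 * s).
set w : R := (sgz k)%:~R * ((\sum_(j < K) nat_digit m j)%N%:R / 2).
have [|a aE] := @horner_linear_form R[i] K (40 * s) 0
    (fun j => Complex ((sgz k)%:~R * (nat_digit m j)%:R) 0) (e w *: p).
  by rewrite (leq_trans (size_scale_leq _ _))// ltnW.
exists a; apply: L0_norm_le.
have carry_le1 i : `|carry R (nat_digit m) i.+1| <= 1.
  by have /andP[c0 c1] := carry_itv R (nat_digit m) i.+1; rewrite ger0_norm.
have := hoeffding_digits K carry_le1 (ler0n _ s); apply: le_trans.
apply: lebesgue_measure_mono => x [/=]; rewrite in_itv /= => /andP[x0 x1] far.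
split; first by rewrite in_itv /= x0 ltW.
rewrite leNgt; apply/negP => /(sum_sawtooth_lt x0 s0).
set Psi := \sum_(j < K) _ => Psis; move: far; apply/negP; rewrite -leNgt.
change (Normc.normc (e (k%:~R * x) - (\sum_f a f *: b f) x) <= eps).
have -> : (\sum_f a f *: b f) x = e w * p.[Complex ((sgz k)%:~R * Psi) 0].
  rewrite -hornerZ fct_sumE.
  have -> : Complex ((sgz k)%:~R * Psi) 0 = 0 + \sum_(j < K)
      Complex ((sgz k)%:~R * (nat_digit m j)%:R) 0 * Complex (h x j) 0.
    rewrite add0r !complexr0 mulr_sumr rmorph_sum; apply: eq_bigr => j _.
    by rewrite !complexr0 -rmorphM mulrA.
  by rewrite aE; apply: eq_bigr => f _; rewrite -bE.
rewrite (e_binary_phase _ kK) -/m -/w -/Psi -mulrBr Normc.normcM normc_e mul1r.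
apply: (le_trans (pE _)); rewrite ler_pM2l// ler_expR.
have sgPsi : `|(sgz k)%:~R * Psi| <= s%:R.
  rewrite normrM (le_trans _ Psis)// ler_piMl//.
  by case: sgzP => _; rewrite ?normrN ?normr1 ?normr0.
have K0 : (0 : R) < K%:R.
  by rewrite ltr0n; move: s0 sK; case: (K) => //; rewrite muln0; case: (s).
have sq_le : s%:R ^+ 2 / (8 * K%:R) <= 2 * s%:R :> R.
  rewrite ler_pdivrMr ?mulr_gt0// expr2 mulrAC ler_wpM2r// mulrA -natrM -natrM.
  by rewrite ler_nat.
have s_ge0 : (0 : R) <= s%:R by [].
rewrite natrM; move: sq_le sgPsi s_ge0; set q := _ / _; set r := `|_|.
by clearbody q r; lra.
Qed.

(** * Choice of the parameters *)

Lemma ln2_ge_half (R : realType) : 1 / 2 <= ln (2 : R).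
Proof.
rewrite -[1 / 2]expRK ler_ln ?posrE ?expR_gt0//.
rewrite -[expR _]invrK -expRN invf_ple ?posrE ?expR_gt0//.
by apply: le_trans (expR_ge1Dx _); lra.
Qed.

Lemma ln2_le1 (R : realType) : ln (2 : R) <= 1.
Proof.
rewrite -[leRHS]expRK ler_ln ?posrE ?expR_gt0//.
by apply: le_trans (expR_ge1Dx _); lra.
Qed.

Lemma ln_le_powR (R : realType) (x a : R) : 0 < a -> 0 < x ->
  ln x <= a^-1 * x `^ a.
Proof.
move=> a0 x0; rewrite ler_pdivlMl// -ln_powR.
have := @expR_ge1Dx R (ln (x `^ a)); rewrite lnK ?posrE ?powR_gt0//; lra.
Qed.

(** As [ln N >= 1 / 2] when [N >= 2], powers of [ln N] are bounded below; this
    absorbs additive constants, so that no separate treatment of small [N] is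
    needed beyond [N = 1]. *)
Lemma half_powR_ge (R : realType) (x a : R) : 1 / 2 <= x -> 0 <= a <= 1 ->
  1 / 2 <= x `^ a.
Proof.
move=> x12 /andP[a0 a1]; have [x1|x1] := leP 1 x.
  by rewrite (le_trans _ (ler_powR x1 a0))// powRr0; lra.
by rewrite (le_trans x12)// ger1_powR//; apply/andP; split; lra.
Qed.

Lemma ln_nat_ge_half (R : realType) (N : nat) : (2 <= N)%N ->
  1 / 2 <= ln (N%:R : R).
Proof.
move=> N2; have N0 : (0 < N)%N by exact: leq_trans N2.
by rewrite (le_trans (ln2_ge_half R))// ler_ln ?posrE ?ltr0n// ler_nat.
Qed.

(** [K] is the number of binary digits of [N] and [s] is 16 times [L ^ (5 / 8)]
    rounded up. Then [s ^ 2 / 8 K] is of order [L ^ (5 / 4 - 1)]. The factor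
    [ln (K + 1)] in the logarithm of the dimension is at most a multiple of
    [L ^ (1 / 24)], and [5 / 8 + 1 / 24 = 2 / 3]. The factor 16 lets the exponent beat the factor 2
    in front of the exponential even for [N = 2]. *)
Lemma width_parameters (R : realType) (N : nat) : (2 <= N)%N ->
  let L := ln N%:R : R in
  exists K s : nat, [/\ (N < 2 ^ K)%N, (0 < s <= 16 * K)%N,
    (K.+1 ^ (40 * s))%:R <= expR (2 ^+ 20 * L `^ (2 / 3)) &
    2 * expR (- (s%:R ^+ 2 / (8 * K%:R))) <= expR (- 2 * L `^ (1 / 4))].
Proof.
move=> N2 L.
have N0 : (0 < N)%N by exact: leq_trans N2.
have NR0 : (0 : R) < N%:R by rewrite ltr0n.
have ln2h := ln2_ge_half R; have ln21 := ln2_le1 R.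
have L12 : 1 / 2 <= L by exact: ln_nat_ge_half.
have L0 : 0 < L by lra.
pose K := (trunc_log 2 N).+1.
have NK : (N < 2 ^ K)%N by exact: trunc_log_ltn.
have K1 : (1 < K)%N by rewrite ltnS trunc_log_max.
have LK : L < K%:R.
  have : L < ln (2 ^+ K) by rewrite ltr_ln ?posrE ?exprn_gt0// -natrX ltr_nat.
  rewrite lnXn// -[ln 2 *+ K]mulr_natl => /lt_le_trans; apply.
  by rewrite ler_piMr.
have KL : K%:R <= 4 * L.
  have : ln (2 ^+ (trunc_log 2 N)) <= L.
    by rewrite ler_ln ?posrE ?exprn_gt0// -natrX ler_nat trunc_logP.
  rewrite lnXn// -[ln 2 *+ _]mulr_natl /K -natr1.
  have : (0 : R) <= (trunc_log 2 N)%:R by [].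
  nra.
pose q := (Num.truncn (L `^ (5 / 8))).+1.
have /andP[q1 q2] : L `^ (5 / 8) <= q%:R <= L `^ (5 / 8) + 1.
  have /andP[h1 h2] := truncn_itv (powR_ge0 L (5 / 8)).
  by rewrite (ltW h2) /q -natr1 lerD2r.
have p58 : 1 / 2 <= L `^ (5 / 8) by apply: half_powR_ge => //; apply/andP; split; lra.
have p14 : 1 / 2 <= L `^ (1 / 4) by apply: half_powR_ge => //; apply/andP; split; lra.
have Lpow (a b : R) : L `^ (a + b) = L `^ a * L `^ b.
  by rewrite powRD// (gt_eqF L0) implybT.
have Kp : (0 : R) < K%:R by rewrite ltr0n.
exists K, (16 * q)%N; split => //.
- rewrite leq_mul2l /= truncn_lt_nat ?powR_ge0//.
  have [L1|L1] := leP 1 L.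
    by apply: le_lt_trans LK; rewrite ler1_powR//; lra.
  apply: (@le_lt_trans _ _ 1); last by rewrite ltr1n.
  by rewrite -[leRHS](powRr0 L) ger_powR// L0 ltW.
- rewrite natrX -[K.+1%:R in leLHS]lnK ?posrE ?ltr0n// -expRM_natl ler_expR.
  have lnK1 : ln K.+1%:R <= 24 * (6 * L `^ (1 / 24)).
    have := @ln_le_powR R K.+1%:R (1 / 24) ltac:(lra) (ltr0Sn _ _).
    rewrite div1r invrK => /le_trans; apply; rewrite ler_pM2l// -div1r.
    apply: (@le_trans _ _ ((6 * L) `^ (1 / 24))).
      have K6 : K.+1%:R <= 6 * L by rewrite -natr1; lra.
      by rewrite ge0_ler_powR ?nnegrE//; lra.
    rewrite powRM; [|lra|lra]; rewrite ler_wpM2r ?powR_ge0// ler1_powR//; lra.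
  have -> : 2 / 3 = 5 / 8 + 1 / 24 :> R by lra.
  rewrite Lpow !natrM.
  have q3 : q%:R <= 3 * L `^ (5 / 8) by lra.
  have P0 : 0 <= 24 * (6 * L `^ (1 / 24)) by rewrite !mulr_ge0 ?powR_ge0.
  have Q0 : (0 : R) <= 40%:R * (16%:R * q%:R) by rewrite !mulr_ge0.
  apply: (le_trans (ler_wpM2l Q0 lnK1)).
  have Q1 : 40%:R * (16%:R * q%:R) <= 40%:R * (16%:R * (3 * L `^ (5 / 8))) by lra.
  apply: (le_trans (ler_wpM2r P0 Q1)).
  have PQ : 0 <= L `^ (5 / 8) * L `^ (1 / 24) by rewrite mulr_ge0 ?powR_ge0.
  by move: PQ; set a := _ `^ (5 / 8); set b := _ `^ (1 / 24) => PQ; nra.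
- have exp2 : 2 <= expR (2 * L `^ (1 / 4)).
    by apply: le_trans (expR_ge1Dx _); lra.
  apply: (le_trans (ler_wpM2r (expR_ge0 _) exp2)); rewrite -expRD ler_expR.
  suff : 8 * L `^ (1 / 4) <= (16 * q)%:R ^+ 2 / (8 * K%:R) by lra.
  rewrite ler_pdivlMr ?mulr_gt0//.
  have qq : L * L `^ (1 / 4) <= q%:R ^+ 2.
    have -> : L * L `^ (1 / 4) = (L `^ (5 / 8)) ^+ 2.
      by rewrite -[X in X * _]powRr1 ?(ltW L0)// -Lpow expr2 -Lpow; congr (_ `^ _); lra.
    by rewrite lerXn2r ?nnegrE ?powR_ge0.
  have KLL : K%:R * L `^ (1 / 4) <= 4 * L * L `^ (1 / 4).
    by rewrite ler_wpM2r ?powR_ge0.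
  rewrite natrM exprMn; lra.
Qed.

(** The zero subspace already gives the bound needed for [N = 1], where the
    right hand sides of the theorem are 1. *)
Lemma kolmogorov_width_le_radius (R : realType) (K : nzRingType) (V : lmodType K)
    (X : set V) (nrm : V -> \bar R) (n : nat) (S : set V) (eps : \bar R) :
  X 0 -> (forall x, S x -> (nrm x <= eps)%E) ->
  (kolmogorov_width X nrm n S <= eps)%E.
Proof.
move=> X0 Snrm; apply: (@kolmogorov_width_le _ _ _ _ _ _ _ 'I_0 (fun=> 0)).
- by rewrite card_ord.
- by move=> a; rewrite big_ord0.
- by move=> x Sx; exists (fun=> 0); rewrite big_ord0 subr0; exact: Snrm.
Qed.

Lemma width_walsh_le1 (R : realType) (n N : nat) :
  (width_LH_unit_interval n (@walsh_system R N) <= 1)%E.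
Proof.
apply: kolmogorov_width_le_radius => [|f _]; first exact: measurable_cst.
apply: (@le_trans _ _ (@lebesgue_measure R `[0%R, 1%R])).
  by apply: lebesgue_measure_mono => x [].
by rewrite lebesgue_measure_itv /= lte_fin ltr01 oppr0 adde0.
Qed.

Lemma width_trig_le1 (R : realType) (n N : nat) :
  (width_L0_torus n (@trig_system R N) <= 1)%E.
Proof.
apply: kolmogorov_width_le_radius => [|f _].
  by split => [//||]; exact: measurable_cst.
apply: L0_norm_le; apply: (@le_trans _ _ (@lebesgue_measure R `[0%R, 1%R[)).
  by apply: lebesgue_measure_mono => x [].
by rewrite lebesgue_measure_itv /= lte_fin ltr01 oppr0 adde0.
Qed.

Theorem theorem1p4 (R : realType) :
  exists c C : R, [/\ 0 < c, 0 < C &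
    forall N : nat, (1 <= N)%N ->
      (forall n : nat, expR (C * ln N%:R `^ (2 / 3)) <= n%:R ->
        (width_LH_unit_interval n (@walsh_system R N)
         <= (expR (- c * ln N%:R `^ (1 / 4)))%:E)%E)
      /\
      (forall n : nat, expR (C * ln N%:R `^ (9 / 10)) <= n%:R ->
        (width_L0_torus n (@trig_system R N)
         <= (expR (- c * ln N%:R `^ (1 / 5)))%:E)%E)].
Proof.
exists 1, (2 ^+ 21); split=> [//||N N1]; first by rewrite exprn_gt0.
have [N2|N2] := leqP 2 N; last first.
  have -> : N = 1%N by apply/eqP; rewrite eqn_leq N1 -ltnS N2.
  rewrite ln1 !powR0 ?mulr0 ?expR0//; try lra.
  by split=> n _; [exact: width_walsh_le1 | exact: width_trig_le1].
have [K [s [NK sK dim small]]] := width_parameters R N2.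
have L12 := ln_nat_ge_half R N2; set L : R := ln N%:R in L12 dim small *.
have [/andP[L0 _] s0] : 0 < L <= L /\ (0 < s)%N by split; [lra|case/andP: sK].
have Lpow (a b : R) : L `^ (a + b) = L `^ a * L `^ b.
  by rewrite powRD// (gt_eqF L0) implybT.
(* As [L >= 1 / 2] only, the monotonicity of powers in the exponent holds up to
   a factor 2, absorbed in the constants. *)
have monoL (a b : R) : a <= b <= a + 1 -> L `^ a <= 2 * L `^ b.
  move=> /andP[ab ba]; rewrite -[b](subrKC a) Lpow mulrCA ler_peMr ?powR_ge0//.
  have : 1 / 2 <= L `^ (b - a) by apply: half_powR_ge => //; apply/andP; split; lra.
  lra.
have dim_le n (a : R) : 2 / 3 <= a <= 5 / 3 -> expR (2 ^+ 21 * L `^ a) <= n%:R ->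
    (K.+1 ^ (40 * s) <= n)%N.
  move=> /andP[a1 a2] an; rewrite -(ler_nat R); apply: (le_trans dim).
  apply: le_trans an; rewrite ler_expR [2 ^+ 21]exprSr -mulrA ler_pM2l ?exprn_gt0//.
  by apply: monoL; apply/andP; split; lra.
split=> n /dim_le dn.
- have {}dn : (K.+1 ^ s <= n)%N.
    apply: leq_trans (dn _); last by apply/andP; split; lra.
    by rewrite leq_pexp2l// leq_pmull.
  apply: (le_trans (width_walsh_le R NK dn)); rewrite lee_fin.
  apply: (le_trans small); rewrite ler_expR.
  by have := powR_ge0 L (1 / 4); lra.
- have {}dn : (K.+1 ^ (40 * s) <= n)%N by apply: dn; apply/andP; split; lra.
  apply: (le_trans (width_trig_le R NK sK dn)); rewrite lee_fin.
  apply: (le_trans small); rewrite ler_expR.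
  have : L `^ (1 / 5) <= 2 * L `^ (1 / 4) by apply: monoL; apply/andP; split; lra.
  lra.
Qed.
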